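(* Let $A, B \in \mathbb{C}^{n \times n}$ be group invertible. Then the following statements are equivalent: (i) $A^\#+B^\#=A^\#(A+B)B^\#$; (ii) $R(A^* )\subseteq R(B^* )$ and $R(B)\subseteq R(A)$.
   Context: $R(X)$ denotes the range (column space) of a matrix $X$ and $X^*$ its conjugate transpose. A square matrix $X$ is group invertible if there is a matrix $Y$ with $XYX=X$, $YXY=Y$ and $XY=YX$ (equivalently, $\mathrm{rank}(X^2)=\mathrm{rank}(X)$); such a $Y$ is unique, is called the group inverse of $X$, and is denoted $X^{\#}$. *)

(* Defs.v *)
From mathcomp Require Import all_boot all_order all_algebra.
From mathcomp Require Import complex.
From mathcomp Require Import boolp classical_sets reals.

Set Implicit Arguments.
Unset Strict Implicit.
Unset Printing Implicit Defensive.

Import GRing.Theory Num.Theory.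
Local Open Scope ring_scope.
Local Open Scope classical_set_scope.

(* MathComp's subspace order [(_ <= _)%MS] compares row spaces, hence an
   explicit column space. *)
Definition mxrange (R : realType) (m n : nat) (X : 'M[R[i]]_(m, n)) :
    set 'cV[R[i]]_m :=
  range (fun v : 'cV[R[i]]_n => X *m v).

Definition is_group_inverse (R : realType) (n : nat) (X Y : 'M[R[i]]_n) : Prop :=
  [/\ X *m Y *m X = X, Y *m X *m Y = Y & X *m Y = Y *m X].

Definition group_invertible (R : realType) (n : nat) (X : 'M[R[i]]_n) : Prop :=
  exists Y : 'M[R[i]]_n, is_group_inverse X Y.

(* Total function: junk value 0 when [X] is not group invertible. *)
Definition group_inverse (R : realType) (n : nat) (X : 'M[R[i]]_n) : 'M[R[i]]_n :=
  xget 0 [set Y | is_group_inverse X Y].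

Lemma is_group_inverse_unique (R : realType) (n : nat) (X Y Z : 'M[R[i]]_n) :
  is_group_inverse X Y -> is_group_inverse X Z -> Y = Z.
Proof.
move=> [XYX YXY cXY] [XZX ZXZ cXZ].
have E : X *m Y = X *m Z.
  transitivity (X *m Z *m (X *m Y)); first by rewrite mulmxA XZX.
  by rewrite cXZ cXY -mulmxA [X *m (Y *m X)]mulmxA XYX.
by rewrite -YXY -cXY E cXZ -mulmxA E mulmxA ZXZ.
Qed.

Lemma group_inverseP (R : realType) (n : nat) (X : 'M[R[i]]_n) :
  group_invertible X -> is_group_inverse X (group_inverse X).
Proof. exact: xgetPex. Qed.

Lemma group_inverse_eq (R : realType) (n : nat) (X Y : 'M[R[i]]_n) :
  is_group_inverse X Y -> group_inverse X = Y.
Proof.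
move=> hY; have hX : group_invertible X by exists Y.
exact: is_group_inverse_unique (group_inverseP hX) hY.
Qed.

(* Main.v *)
(* Right multiplication of (i) by I - B B^# kills every term except A^#, and left
   multiplication by I - A A^# kills every term except B^#, so (i) amounts to
   A^# = A^# B B^# and B^# = A A^# B^#, equivalently to A = A B^# B and
   B = A A^# B; these two factorizations express the range inclusions. *)
Require Import Defs.
From mathcomp Require Import all_boot all_order all_algebra.
From mathcomp Require Import complex.
From mathcomp Require Import boolp classical_sets reals.

Local Open Scope ring_scope.
Local Open Scope classical_set_scope.
Local Open Scope sesquilinear_scope.

Import GRing.Theory.

(** Each column of [X] is the image of a standard basis vector; preimages under [Y], picked by
    choice, serve as the columns of [M]. *)
Lemma mxrange_subP (R : realType) (m n p : nat)
    (X : 'M[R[i]]_(m, n)) (Y : 'M[R[i]]_(m, p)) :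
  mxrange X `<=` mxrange Y <-> exists M, X = Y *m M.
Proof.
split=> [sXY | [M ->] _ [v _ <-]]; last by exists (M *m v) => //; rewrite mulmxA.
have colE j : exists w, Y *m w = col j X.
  have [|w _ <-] := sXY (col j X); last by exists w.
  by exists (delta_mx j 0) => //; rewrite colE.
have [f fE] := choice colE.
exists (\matrix_(i, j) f j i 0); apply/matrixP => i j.
have /matrixP/(_ i 0) := fE j; rewrite !mxE => <-.
by apply: eq_bigr => k _; rewrite mxE.
Qed.

Lemma trmxC_mul (C : numClosedFieldType) (m n p : nat)
    (X : 'M[C]_(m, n)) (Y : 'M[C]_(n, p)) :
  (X *m Y) ^t* = Y ^t* *m X ^t*.
Proof. by rewrite trmx_mul map_mxM. Qed.

(** Conjugate transposition is an involution that reverses products, so a right factor becomes a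
    left one. *)
Lemma mxrange_trmxC_subP (R : realType) (m n p : nat)
    (X : 'M[R[i]]_(m, n)) (Y : 'M[R[i]]_(p, n)) :
  mxrange (X ^t* ) `<=` mxrange (Y ^t* ) <-> exists M, X = M *m Y.
Proof.
rewrite mxrange_subP; split=> [[M XYM] | [M ->]].
  by exists (M ^t* ); rewrite -(trmxCK X) XYM trmxC_mul trmxCK.
by exists (M ^t* ); rewrite trmxC_mul.
Qed.

Section GroupInverse.
Context {R : realType} {n : nat}.
Implicit Types A B G H : 'M[R[i]]_n.

Lemma group_inverse_addE A B G H :
  is_group_inverse A G -> is_group_inverse B H ->
  G + H = G *m (A + B) *m H <-> G = G *m B *m H /\ H = A *m G *m H.
Proof.
move=> [AGA GAG cAG] [BHB HBH cBH]; split=> [eqGH | [GE HE]]; last first.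
  by rewrite mulmxDr mulmxDl -cAG -HE -GE addrC.
have GE : G = G *m B *m H.
  (* The right side ends in [H = H *m B *m H], so [B *m H] fixes [G + H] from the right; it fixes
     [H] too, and [H] cancels. *)
  have := congr1 (fun X => X *m (B *m H)) eqGH.
  rewrite -(mulmxA _ H) !(mulmxA H) HBH -eqGH mulmxDl (mulmxA H) HBH mulmxA.
  by move=> /addIr.
(* With [GE], the expanded right side is [G *m A *m H + G]; cancelling [G] replaces a second
   multiplication. *)
split=> //; apply: (addrI G).
by rewrite {1}eqGH mulmxDr mulmxDl -GE addrC cAG.
Qed.

(** By commutation [A = A *m A *m G] and [G = G *m G *m A], so right multiplication by
    [B *m H = H *m B] fixes [A] exactly when it fixes [G]; it fixes every left multiple of [B]. *)
Lemma mulmx_group_inverse_eqr A B G H :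
  is_group_inverse A G -> is_group_inverse B H ->
  G = G *m B *m H <-> exists M, A = M *m B.
Proof.
move=> [AGA GAG cAG] [BHB HBH cBH]; split=> [GE | [M AE]].
  exists (A *m H).
  by rewrite -{1}AGA -mulmxA -cAG {1}GE -(mulmxA G) cBH !mulmxA -(mulmxA A A)
             cAG mulmxA AGA.
have ABH : A *m (B *m H) = A by rewrite cBH AE -mulmxA (mulmxA B) BHB.
by rewrite -{1}GAG -mulmxA cAG -{1}ABH !mulmxA -(mulmxA G G) -cAG mulmxA GAG.
Qed.

(** Mirror argument: [B = H *m B *m B] and [H = B *m H *m H], while [A *m G] fixes every right
    multiple of [A]. *)
Lemma mulmx_group_inverse_eql A B G H :
  is_group_inverse A G -> is_group_inverse B H ->
  H = A *m G *m H <-> exists M, B = A *m M.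
Proof.
move=> [AGA GAG cAG] [BHB HBH cBH]; split=> [HE | [M BE]].
  by exists (G *m H *m B *m B); rewrite -{1}BHB cBH {1}HE !mulmxA.
by rewrite -{2}HBH -cBH {1}BE !mulmxA AGA -BE cBH HBH.
Qed.

End GroupInverse.

Theorem theorem4p4 (R : realType) (n : nat) (A B : 'M[R[i]]_n)
    (hA : group_invertible A) (hB : group_invertible B) :
  group_inverse A + group_inverse B
    = group_inverse A *m (A + B) *m group_inverse B
  <->
  (mxrange (A ^t* ) `<=` mxrange (B ^t* ) /\ mxrange B `<=` mxrange A).
Proof.
have hG := @group_inverseP _ _ _ hA; have hH := @group_inverseP _ _ _ hB.
rewrite (group_inverse_addE _ _ _ _ hG hH).
rewrite (mulmx_group_inverse_eqr _ _ _ _ hG hH).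
by rewrite (mulmx_group_inverse_eql _ _ _ _ hG hH) mxrange_trmxC_subP mxrange_subP.
Qed.
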